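(* Let $(M,g)$ be a smooth Riemannian manifold, let $\Delta=\mathrm d\delta+\delta\mathrm d$ be its Hodge Laplacian (with $\delta$ the divergence) extended to $\Omega^1(M)\otimes_{C^\infty(M)}\Omega^1(M)$ by $$\Delta(\omega\otimes\eta)=\Delta\omega\otimes\eta+\omega\otimes\Delta\eta+2\nabla_{g^1}\omega\otimes\nabla_{g^2}\eta .$$ Then $$\mathrm{Ricci}=-\tfrac12\,\Delta(g).$$
   Context: $A=C^\infty(M)$ and $\Omega^1(M)$ is the module of smooth 1-forms; $g=g^1\otimes g^2\in\Omega^1(M)\otimes_{A}\Omega^1(M)$ (sum of such terms understood) is the metric, and $(\ ,\ )$ the inverse metric on 1-forms. For a 1-form $\omega$, $\nabla_\omega$ is the Levi-Civita covariant derivative on differential forms along the vector field $(\omega,\mathrm d(\ ))$ metrically dual to $\omega$, and $\mathfrak i_\omega$ is the interior product by that vector field. The codifferential is taken with the sign convention $\delta=\mathfrak i_{g^1}\nabla_{g^2}$ (the divergence; it is adjoint to $-\mathrm d$), so that $\Delta=\mathrm d\delta+\delta\mathrm d$ agrees with the Laplace–Beltrami operator on functions. The displayed extension of $\Delta$ is well defined on $\otimes_A$. The curvature is $R(\omega,\eta)\zeta=\nabla_\omega\nabla_\eta\zeta-\nabla_\eta\nabla_\omega\zeta-\nabla_{[\omega,\eta]}\zeta$ for 1-forms, $[\omega,\eta]$ being the 1-form dual to the Lie bracket of the vector fields dual to $\omega,\eta$. Put $\widetilde{\mathrm{Ricci}}(\omega)=R(\omega,g^1)g^2$ and $\mathrm{Ricci}=g^1\otimes\widetilde{\mathrm{Ricci}}(g^2)\in\Omega^1(M)\otimes_A\Omega^1(M)$.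 *)

(* Defs.v *)
From HB Require Import structures.
From mathcomp Require Import all_boot all_order all_algebra.
From mathcomp Require Import all_classical all_reals all_analysis.
From mathcomp Require Import ring.

Set Implicit Arguments.
Unset Strict Implicit.
Unset Printing Implicit Defensive.

Import Order.TTheory GRing.Theory Num.Theory.
Import numFieldNormedType.Exports.
Local Open Scope classical_set_scope.
Local Open Scope ring_scope.
Local Open Scope quotient_scope.

Section SmoothRn.
Variables (R : realType) (n : nat).
Implicit Types (V : set 'rV[R]_n) (f g : 'rV[R]_n -> R).

(* Only meant for open V: at the points of V, f is continuous, and its partial
   derivatives up to order k exist and are continuous. *)
Fixpoint Ck_on (k : nat) V f : Prop :=
  (forall x, V x -> {for x, continuous f}) /\
  if k is k'.+1 then
    forall i : 'I_n, (forall x, V x -> derivable f x (delta_mx 0 i)) /\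
      Ck_on k' V (fun x => 'D_(delta_mx 0 i) f x)
  else True.

Definition smooth_on V f : Prop := forall k, Ck_on k V f.

Lemma Ck_on_cont k V f : Ck_on k V f -> forall x, V x -> {for x, continuous f}.
Proof. by case: k => [|k] []. Qed.

Lemma eq_Ck_on k V f g : open V -> (forall x, V x -> f x = g x) ->
  Ck_on k V f -> Ck_on k V g.
Proof.
move=> oV; elim: k f g => [|k IHk] f g fg.
all: have near_fg x : V x -> \forall y \near x, f y = g y
  by move=> Vx; apply: filterS (open_nbhs_nbhs (conj oV Vx)) => y /fg.
all: have contg : (forall x, V x -> {for x, continuous f}) ->
    forall x, V x -> {for x, continuous g}
  by move=> cf x Vx; apply: cvg_trans (near_eq_cvg (near_fg x Vx)) _;
     rewrite -(fg x Vx); exact: cf.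
  by case=> cf _; split=> //; apply: contg.
case=> cf df; split=> [|i]; first exact: contg.
have [dfi Cdf] := df i; split=> [x Vx|].
  exact: near_eq_derivable (near_fg x Vx) (dfi x Vx).
by apply: IHk Cdf => x Vx; apply: near_eq_derive; exact: near_fg.
Qed.

Lemma Ck_onS k V f : Ck_on k.+1 V f -> Ck_on k V f.
Proof.
elim: k f => [|k IHk] f [cf df]; split=> // i.
by have [dfi Cdf] := df i; split=> //; apply: IHk.
Qed.

Lemma Ck_on_cst k V (c : R) : Ck_on k V (cst c).
Proof.
elim: k c => [|k IHk] c; (split; first by move=> x _; exact: cst_continuous) => // i.
split=> [x _|]; first exact: derivable_cst.
rewrite (_ : (fun x => _) = cst 0); first exact: IHk.
by apply/funext => x; rewrite derive_cst.
Qed.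

Lemma Ck_onD k V f g : open V -> Ck_on k V f -> Ck_on k V g -> Ck_on k V (f + g).
Proof.
move=> oV; elim: k f g => [|k IHk] f g [cf df] [cg dg].
  by split=> // x Vx; exact: continuousD (cf x Vx) (cg x Vx).
split=> [x Vx|i]; first exact: continuousD (cf x Vx) (cg x Vx).
have [dfi Cdf] := df i; have [dgi Cdg] := dg i; split=> [x Vx|].
  by apply: derivableD; [exact: dfi | exact: dgi].
apply: eq_Ck_on (IHk _ _ Cdf Cdg) => // x Vx.
by rewrite deriveD //; [exact: dfi | exact: dgi].
Qed.

Lemma Ck_onM k V f g : open V -> Ck_on k V f -> Ck_on k V g -> Ck_on k V (f * g).
Proof.
move=> oV; elim: k f g => [|k IHk] f g Cf Cg.
  split=> // x Vx; exact: continuousM (Ck_on_cont Cf Vx) (Ck_on_cont Cg Vx).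
split=> [x Vx|i].
  exact: continuousM (Ck_on_cont Cf Vx) (Ck_on_cont Cg Vx).
have [dfi Cdf] := Cf.2 i; have [dgi Cdg] := Cg.2 i; split=> [x Vx|].
  by apply: derivableM; [exact: dfi | exact: dgi].
apply: eq_Ck_on (Ck_onD oV (IHk _ _ (Ck_onS Cf) Cdg) (IHk _ _ (Ck_onS Cg) Cdf)) => //.
by move=> x Vx; rewrite deriveM //; [exact: dfi | exact: dgi].
Qed.

End SmoothRn.

(* chart_inv is total; its values outside chart_cod are irrelevant. *)
Record chart (R : realType) (n : nat) (M : topologicalType) := Chart {
  chart_dom : set M;
  chart_cod : set 'rV[R]_n;
  chart_map : M -> 'rV[R]_n;
  chart_inv : 'rV[R]_n -> M;
  chart_dom_open : open chart_dom;
  chart_cod_open : open chart_cod;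
  chart_map_cod : forall x, chart_dom x -> chart_cod (chart_map x);
  chart_inv_dom : forall y, chart_cod y -> chart_dom (chart_inv y);
  chart_mapK : forall x, chart_dom x -> chart_inv (chart_map x) = x;
  chart_invK : forall y, chart_cod y -> chart_map (chart_inv y) = y;
  chart_map_cont : forall x, chart_dom x -> {for x, continuous chart_map};
  chart_inv_cont : forall y, chart_cod y -> {for y, continuous chart_inv}
}.

Record smooth_manifold (R : realType) (n : nat) := SmoothManifold {
  manifold_space :> topologicalType;
  manifold_hausdorff : hausdorff_space manifold_space;
  manifold_second_countable : @second_countable manifold_space;
  manifold_atlas : set (chart R n manifold_space);
  manifold_cover : forall x : manifold_space,
    exists2 c, manifold_atlas c & chart_dom c x;
  manifold_compat : forall c c', manifold_atlas c -> manifold_atlas c' ->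
    forall i : 'I_n,
      smooth_on (chart_map c @` (chart_dom c `&` chart_dom c'))
                (fun y => chart_map c' (chart_inv c y) 0 i)
}.

Section SmoothFunctions.
Variables (R : realType) (n : nat) (M : smooth_manifold R n).

Definition is_smooth (f : M -> R) : Prop :=
  forall c, manifold_atlas c -> smooth_on (chart_cod c) (f \o chart_inv c).

Definition smoothb : {pred M -> R} := fun f => `[< is_smooth f >].

Let smooth_cst (a : R) : is_smooth (cst a).
Proof. by move=> c _ k; exact: Ck_on_cst. Qed.

Let smoothD f g : is_smooth f -> is_smooth g -> is_smooth (f + g).
Proof.
by move=> sf sg c cA k; apply: Ck_onD (sf c cA k) (sg c cA k); exact: chart_cod_open.
Qed.

Let smoothM f g : is_smooth f -> is_smooth g -> is_smooth (f * g).
Proof.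
by move=> sf sg c cA k; apply: Ck_onM (sf c cA k) (sg c cA k); exact: chart_cod_open.
Qed.

Lemma smooth_subring_closed : subring_closed smoothb.
Proof.
split=> [|f g /asboolP sf /asboolP sg|f g /asboolP sf /asboolP sg]; apply/asboolP.
- exact: smooth_cst.
- rewrite (_ : f - g = f + cst (-1) * g); first by apply: smoothD => //; exact: smoothM.
  by apply/funext => x; rewrite !fctE mulN1r.
- exact: smoothM.
Qed.

Lemma smooth_scaler_closed : scaler_closed smoothb.
Proof. by move=> a f /asboolP sf; apply/asboolP; exact: smoothM (smooth_cst a) sf. Qed.

HB.instance Definition _ :=
  GRing.isSubringClosed.Build (M -> R) smoothb smooth_subring_closed.
HB.instance Definition _ :=
  GRing.isScaleClosed.Build R (M -> R) smoothb smooth_scaler_closed.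

Record smooth_fun := SmoothFun {
  smooth_val :> M -> R;
  _ : smooth_val \in smoothb
}.

HB.instance Definition _ := [isSub for smooth_val].
HB.instance Definition _ := [Choice of smooth_fun by <:].
HB.instance Definition _ := 
  GRing.SubChoice_isSubComPzRing.Build _ _ smooth_fun smooth_subring_closed.
HB.instance Definition _ := [SubZmodule_isSubLmodule of smooth_fun by <:].

End SmoothFunctions.
Section TensorProduct.
Variables (A : comPzRingType) (U V : lmodType A).

Definition bilinear_map (W : lmodType A) (B : U -> V -> W) : Prop :=
  (forall u, linear (B u)) /\ (forall v, linear (B ^~ v)).

Definition formal_sum (W : lmodType A) (B : U -> V -> W) (s : seq (U * V)) : W :=
  \sum_(x <- s) B x.1 x.2.

(* Two formal sums of pairs represent the same element of the tensor product
   over A iff no A-bilinear map distinguishes them. *)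
Definition tensor_eq : rel (seq (U * V)) := fun s t =>
  `[< forall (W : lmodType A) (B : U -> V -> W),
        bilinear_map B -> formal_sum B s = formal_sum B t >].

Lemma tensor_eqP s t :
  reflect (forall (W : lmodType A) (B : U -> V -> W),
             bilinear_map B -> formal_sum B s = formal_sum B t) (tensor_eq s t).
Proof. exact: asboolP. Qed.

Lemma tensor_eq_refl : reflexive tensor_eq.
Proof. by move=> s; apply/tensor_eqP. Qed.

Lemma tensor_eq_sym : symmetric tensor_eq.
Proof.
by move=> s t; apply/tensor_eqP/tensor_eqP => st W B BB; rewrite (st W B BB).
Qed.

Lemma tensor_eq_trans : transitive tensor_eq.
Proof.
move=> t s r /tensor_eqP st /tensor_eqP tr; apply/tensor_eqP => W B BB.
by rewrite (st W B BB) (tr W B BB).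
Qed.

Canonical tensor_equiv :=
  EquivRel tensor_eq tensor_eq_refl tensor_eq_sym tensor_eq_trans.

Definition tensor := {eq_quot tensor_equiv}.
HB.instance Definition _ := Choice.on tensor.

Definition tensor_of_seq (s : seq (U * V)) : tensor := \pi_tensor s.
Definition tmul (u : U) (v : V) : tensor := tensor_of_seq [:: (u, v)].

Lemma tensor_of_seqP s t :
  (forall (W : lmodType A) (B : U -> V -> W),
     bilinear_map B -> formal_sum B s = formal_sum B t) ->
  tensor_of_seq s = tensor_of_seq t.
Proof. by move=> st; apply/eqmodP/tensor_eqP. Qed.

Lemma tensor_ind (P : tensor -> Prop) : (forall s, P (tensor_of_seq s)) -> forall t, P t.
Proof. by move=> Ps t; rewrite -[t]reprK; exact: Ps. Qed.

(* The linear map out of the tensor product induced by a bilinear map B. *)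
Definition tensor_lift (W : lmodType A) (B : U -> V -> W) (t : tensor) : W :=
  formal_sum B (repr t).

Lemma tensor_lift_seq (W : lmodType A) (B : U -> V -> W) s :
  bilinear_map B -> tensor_lift B (tensor_of_seq s) = formal_sum B s.
Proof.
move=> BB; have /eqmodP/tensor_eqP : tensor_of_seq (repr (tensor_of_seq s)) =
  tensor_of_seq s by rewrite /tensor_of_seq reprK.
by apply.
Qed.

Definition tensor0 : tensor := tensor_of_seq [::].
Definition tensor_add (t t' : tensor) : tensor := tensor_of_seq (repr t ++ repr t').
Definition tensor_scale (a : A) (t : tensor) : tensor :=
  tensor_of_seq [seq (a *: x.1, x.2) | x <- repr t].
Definition tensor_opp := tensor_scale (-1).

Lemma formal_sum_cat (W : lmodType A) (B : U -> V -> W) s t :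
  formal_sum B (s ++ t) = formal_sum B s + formal_sum B t.
Proof. by rewrite /formal_sum big_cat. Qed.

Lemma formal_sum_scale (W : lmodType A) (B : U -> V -> W) a s : bilinear_map B ->
  formal_sum B [seq (a *: x.1, x.2) | x <- s] = a *: formal_sum B s.
Proof.
move=> [_ Bl]; rewrite /formal_sum big_map scaler_sumr; apply: eq_bigr => -[u v] _ /=.
have B0 : B 0 v = 0 by have := Bl v (-1) 0 0; rewrite scaler0 addr0 scaleN1r addNr.
by have := Bl v a u 0; rewrite /= addr0 B0 addr0.
Qed.

Lemma tensor_add_seq s t :
  tensor_add (tensor_of_seq s) (tensor_of_seq t) = tensor_of_seq (s ++ t).
Proof.
apply: tensor_of_seqP => W B BB; rewrite !formal_sum_cat.
by congr (_ + _); exact: (tensor_lift_seq _ BB).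
Qed.

Lemma tensor_scale_seq a s :
  tensor_scale a (tensor_of_seq s) = tensor_of_seq [seq (a *: x.1, x.2) | x <- s].
Proof.
apply: tensor_of_seqP => W B BB; rewrite !formal_sum_scale //.
by congr (_ *: _); exact: (tensor_lift_seq _ BB).
Qed.

Let tensor_addA : associative tensor_add.
Proof.
elim/tensor_ind => r; elim/tensor_ind => s; elim/tensor_ind => t.
by rewrite !tensor_add_seq catA.
Qed.

Let tensor_addC : commutative tensor_add.
Proof.
elim/tensor_ind => s; elim/tensor_ind => t; rewrite !tensor_add_seq.
by apply: tensor_of_seqP => W B BB; rewrite !formal_sum_cat addrC.
Qed.

Let tensor_add0 : left_id tensor0 tensor_add.
Proof. by elim/tensor_ind => s; rewrite tensor_add_seq. Qed.

Let tensor_addN : left_inverse tensor0 tensor_opp tensor_add.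
Proof.
elim/tensor_ind => s; rewrite /tensor_opp tensor_scale_seq tensor_add_seq.
apply: tensor_of_seqP => W B BB.
by rewrite formal_sum_cat formal_sum_scale // scaleN1r addNr /formal_sum big_nil.
Qed.

HB.instance Definition _ :=
  GRing.isZmodule.Build tensor tensor_addA tensor_addC tensor_add0 tensor_addN.

Let tensor_scaleA a b t : tensor_scale a (tensor_scale b t) = tensor_scale (a * b) t.
Proof.
elim/tensor_ind: t => s; rewrite !tensor_scale_seq -map_comp.
by congr tensor_of_seq; apply: eq_map => x /=; rewrite scalerA.
Qed.

Let tensor_scale1 : left_id 1 tensor_scale.
Proof.
elim/tensor_ind => s; rewrite tensor_scale_seq.
by apply: tensor_of_seqP => W B BB; rewrite formal_sum_scale // scale1r.
Qed.

Let tensor_scaleDr : right_distributive tensor_scale +%R.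
Proof.
move=> a; elim/tensor_ind => s; elim/tensor_ind => t.
by rewrite /GRing.add /= !(tensor_scale_seq, tensor_add_seq) map_cat.
Qed.

Let tensor_scaleDl t : {morph tensor_scale^~ t : a b / a + b}.
Proof.
move=> a b; elim/tensor_ind: t => s.
rewrite [RHS]/GRing.add /= !(tensor_scale_seq, tensor_add_seq).
apply: tensor_of_seqP => W B BB.
by rewrite formal_sum_cat !formal_sum_scale // scalerDl.
Qed.

HB.instance Definition _ := GRing.Zmodule_isLmodule.Build A tensor
  tensor_scaleA tensor_scale1 tensor_scaleDr tensor_scaleDl.

End TensorProduct.

Arguments tensor {A} U V.
Arguments tmul {A U V}.
Notation "u \ox v" := (tmul u v) (at level 40, left associativity) : ring_scope.

Section VectorFields.
Variables (R : realType) (n : nat) (M : smooth_manifold R n).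
Local Notation A := (smooth_fun M).

Definition derivation (D : A -> A) : Prop :=
  linear D /\ forall f h, D (f * h) = D f * h + f * D h.

Definition derivationb : {pred A -> A^o} := fun D => `[< derivation D >].

Definition cst_smooth (c : R) : A := c *: (1 : A).

Lemma smooth_scaleE (c : R) (f : A) : c *: f = cst_smooth c * f.
Proof.
apply: val_inj; apply/funext => x.
by rewrite -[LHS]/(c * f x) -[RHS]/(c * 1 * f x) mulr1.
Qed.

Lemma derivation_submod_closed : submod_closed derivationb.
Proof.
split=> [|a D E /asboolP[linD leibD] /asboolP[linE leibE]]; apply/asboolP.
  have z f : (0 : A -> A^o) f = 0 by [].
  by split=> [c f h|f h]; rewrite !z ?scaler0 ?mul0r ?mulr0 addr0.
have aE f : (a *: D + E) f = a * D f + E f by [].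
split=> [c f h|f h]; rewrite !aE.
  rewrite linD linE [in RHS]smooth_scaleE !(smooth_scaleE c) !mulrDr addrACA.
  by rewrite mulrCA.
by rewrite leibD leibE !mulrDr mulrDl addrACA -!mulrA (mulrCA a f).
Qed.

HB.instance Definition _ := GRing.isSubmodClosed.Build A (A -> A^o)
  derivationb derivation_submod_closed.

(* Smooth vector fields, as the C^oo(M)-module of R-linear derivations of
   C^oo(M); the tangent vector at p is f |-> X f p. *)
Record vfield := VField {
  vfield_val :> A -> A^o;
  _ : vfield_val \in derivationb
}.

HB.instance Definition _ := [isSub for vfield_val].
HB.instance Definition _ := [Choice of vfield by <:].
HB.instance Definition _ := [SubChoice_isSubLmodule of vfield by <:].

Implicit Types (X Y Z : vfield) (f h : A).

Lemma vfieldP X : derivation X.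
Proof. by case: X => D /= /asboolP. Qed.

Lemma vfield_eqP X Y : (forall f, X f = Y f) -> X = Y.
Proof. by move=> XY; apply: val_inj; apply/funext. Qed.

Lemma vfield_linE (a : A) X Y f : (a *: X + Y) f = a * X f + Y f.
Proof. by []. Qed.

Lemma vfield_leibniz X f h : X (f * h) = X f * h + f * X h.
Proof. by case: (vfieldP X). Qed.

Lemma vfieldB X f h : X (f - h) = X f - X h.
Proof.
by case: (vfieldP X) => lX _; rewrite addrC -scaleN1r lX scaleN1r addrC.
Qed.

Lemma vfield0 X : X 0 = 0.
Proof. by have := vfieldB X 0 0; rewrite !subrr. Qed.

Lemma vfieldD X f h : X (f + h) = X f + X h.
Proof. by case: (vfieldP X) => lX _; have := lX 1 f h; rewrite !scale1r. Qed.

Lemma lie_subproof X Y : (fun f => X (Y f) - Y (X f)) \in derivationb.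
Proof.
apply/asboolP; have [lX _] := vfieldP X; have [lY _] := vfieldP Y.
split=> [c f h|f h].
  by rewrite lX lY lX lY scalerBr opprD addrACA.
rewrite !vfield_leibniz !vfieldD !vfield_leibniz mulrBl mulrBr.
have aux (B : comPzRingType) (a b c d e k : B) :
    (a + b) + (c + d) - ((e + c) + (b + k)) = (a - e) + (d - k) by ring.
exact: aux.
Qed.

Definition lie X Y : vfield := VField (lie_subproof X Y).

Definition form1b : {pred vfield -> A^o} := fun w => `[< linear w >].

Lemma form1_submod_closed : submod_closed form1b.
Proof.
split=> [|a v w /asboolP lv /asboolP lw]; apply/asboolP => b X Y.
  have z Z : (0 : vfield -> A^o) Z = 0 by [].
  by rewrite !z scaler0 addr0.
have avw Z : (a *: v + w) Z = a *: v Z + w Z by [].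
rewrite !avw lv lw !scalerDr !scalerA (mulrC a b).
by rewrite addrACA.
Qed.

HB.instance Definition _ := GRing.isSubmodClosed.Build A (vfield -> A^o)
  form1b form1_submod_closed.

(* Smooth differential forms, as alternating C^oo(M)-multilinear maps on vector
   fields. *)
Record form1 := Form1 {
  form1_val :> vfield -> A^o;
  _ : form1_val \in form1b
}.

HB.instance Definition _ := [isSub for form1_val].
HB.instance Definition _ := [Choice of form1 by <:].
HB.instance Definition _ := [SubChoice_isSubLmodule of form1 by <:].

Record form2 := Form2 {
  form2_val :> vfield -> vfield -> A^o;
  form2_bilinear : bilinear_map form2_val;
  form2_alt : forall X, form2_val X X = 0
}.

Lemma form1P (w : form1) : linear w.
Proof. by case: w => w /= /asboolP. Qed.

Lemma form1_eqP (v w : form1) : (forall X, v X = w X) -> v = w.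
Proof. by move=> vw; apply: val_inj; apply/funext. Qed.

Lemma form1_linE (a : A) (v w : form1) X : (a *: v + w) X = a * v X + w X.
Proof. by []. Qed.

Lemma d0_subproof f : (fun X => X f) \in form1b.
Proof. exact/asboolP. Qed.

Definition d0 f : form1 := Form1 (d0_subproof f).


Lemma form1D (w : form1) X Y : w (X + Y) = w X + w Y.
Proof. by have := form1P w 1 X Y; rewrite !scale1r. Qed.

Lemma form1Z (w : form1) (a : A) X : w (a *: X) = a * w X.
Proof.
have w0 : w 0 = 0 by have := form1P w (-1) 0 0; rewrite scaler0 addr0 scaleN1r addNr.
by have := form1P w a X 0; rewrite !addr0 w0 addr0.
Qed.

Lemma form1N (w : form1) X : w (- X) = - w X.
Proof. by rewrite -scaleN1r form1Z mulN1r. Qed.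

Lemma form1B (w : form1) X Y : w (X - Y) = w X - w Y.
Proof. by rewrite form1D form1N. Qed.

Lemma lie_anti X Y : lie X Y = - lie Y X.
Proof. by apply: vfield_eqP => f; rewrite -[LHS]opprB. Qed.

Lemma lie_linl (a : A) X Y Z :
  lie (a *: X + Y) Z = a *: lie X Z + lie Y Z - (Z a : A) *: X.
Proof.
apply: vfield_eqP => f.
rewrite -[LHS]/(a * X (Z f) + Y (Z f) - Z (a * X f + Y f)).
rewrite -[RHS]/(a * (X (Z f) - Z (X f)) + (Y (Z f) - Z (Y f)) - Z a * X f).
rewrite vfieldD vfield_leibniz.
have aux (C : comPzRingType) (e xz yz za xf zx zy : C) :
  e * xz + yz - (za * xf + e * zx + zy) = e * (xz - zx) + (yz - zy) - za * xf by ring.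
exact: aux.
Qed.

Lemma d1_subproof (w : form1) :
  bilinear_map (fun X Y => X (w Y) - Y (w X) - w (lie X Y) : A^o).
Proof.
pose B X Y : A := X (w Y) - Y (w X) - w (lie X Y).
have linl Z a X Y : B (a *: X + Y) Z = a * B X Z + B Y Z.
  rewrite /B lie_linl form1B !form1D !form1Z vfield_linE vfieldD vfield_leibniz.
  have aux (C : comPzRingType) (e xwz ywz za wx zwx zwy wxz wyz : C) :
    e * xwz + ywz - (za * wx + e * zwx + zwy) - (e * wxz + wyz - za * wx) =
    e * (xwz - zwx - wxz) + (ywz - zwy - wyz) by ring.
  exact: aux.
have anti X Y : B X Y = - B Y X.
  by rewrite /B (lie_anti Y) form1N opprK opprD opprB.
split=> [X a Y Z|Z a X Y]; last exact: linl.
rewrite -[LHS]/(B X (a *: Y + Z)) anti linl opprD -mulrN -!anti.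
by [].
Qed.

Lemma d1_alt (w : form1) X : X (w X) - X (w X) - w (lie X X) = 0 :> A.
Proof.
have -> : lie X X = 0 by apply: vfield_eqP => f; rewrite -[LHS]/(X (X f) - X (X f)) subrr.
by rewrite subrr sub0r -(scale0r X) form1Z mul0r oppr0.
Qed.

(* Convention without the factor 1/2: d(f dh) (X, Y) = X f * Y h - Y f * X h. *)
Definition d1 (w : form1) : form2 := Form2 (d1_subproof w) (d1_alt w).

Lemma form2Dl (b : form2) X Y Z : b (X + Y) Z = b X Z + b Y Z.
Proof.
by case: (form2_bilinear b) => _ bl; have := bl Z 1 X Y; rewrite !scale1r.
Qed.

Lemma form2_iprod_form1b X (b : form2) : b X \in form1b.
Proof. by apply/asboolP; case: (form2_bilinear b). Qed.

Lemma form2_anti (b : form2) X Y : b X Y = - b Y X.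
Proof.
apply/eqP; rewrite -addr_eq0; apply/eqP.
have bD : b (X + Y) (X + Y) = 0 := form2_alt b _.
have bDr W U Z : b W (U + Z) = b W U + b W Z := form1D (Form1 (form2_iprod_form1b W b)) U Z.
by move: bD; rewrite form2Dl !bDr !form2_alt add0r addr0.
Qed.

Lemma form2Zl (b : form2) (a : A) X Z : b (a *: X) Z = a * b X Z.
Proof.
rewrite form2_anti [b X Z]form2_anti mulrN; congr (- _).
exact: (form1Z (Form1 (form2_iprod_form1b Z b)) a X).
Qed.

Definition iprod X (b : form2) : form1 := Form1 (form2_iprod_form1b X b).

(* The bilinear form on vector fields defined by an element of
   Omega^1 (x) Omega^1. *)
Definition tensor_eval (t : tensor form1 form1) X Y : A :=
  tensor_lift (fun v w : form1 => (v X * w Y : A^o)) t.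

(* Positivity of g at the point p is required on nonzero tangent vectors: the
   vector X_p is nonzero iff X f p <> 0 for some f. *)
Record riemannian_metric := RiemannianMetric {
  metric_tensor :> tensor form1 form1;
  metric_sym : forall X Y,
    tensor_eval metric_tensor X Y = tensor_eval metric_tensor Y X;
  metric_pos : forall X (p : M), (exists f : A, smooth_val (X f) p != 0) ->
    0 < smooth_val (tensor_eval metric_tensor X X) p
}.

Lemma bilinear_eval X Y :
  bilinear_map (fun v w : form1 => (v X * w Y : A^o)).
Proof.
split=> u a v w.
  by rewrite -[LHS]/(u X * (a * v Y + w Y)) mulrDr mulrCA.
by rewrite -[LHS]/((a * v X + w X) * u Y) mulrDl -mulrA.
Qed.

Lemma flat_subproof (t : tensor form1 form1) X : tensor_eval t X \in form1b.
Proof.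
apply/asboolP => a Y Z; elim/tensor_ind: t => s; rewrite /tensor_eval.
rewrite !(tensor_lift_seq _ (bilinear_eval _ _)) /formal_sum scaler_sumr -big_split.
by apply: eq_bigr => -[v w] _ /=; rewrite form1D form1Z mulrDr mulrCA.
Qed.

Definition flat (t : tensor form1 form1) X : form1 := Form1 (flat_subproof t X).

Lemma dual_vfield_subproof (l : {linear form1 -> A^o}) :
  (fun f => l (d0 f)) \in derivationb.
Proof.
apply/asboolP; split=> [c f h|f h].
  have -> : d0 (c *: f + h) = cst_smooth c *: d0 f + d0 h.
    apply: form1_eqP => X; rewrite form1_linE /= -smooth_scaleE.
    by case: (vfieldP X) => ->.
  by rewrite linearP [in RHS]smooth_scaleE.
have -> : d0 (f * h) = h *: d0 f + f *: d0 h.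
  apply: form1_eqP => X.
  by rewrite -[LHS]/(X (f * h)) vfield_leibniz (mulrC (X f)).
by rewrite linearD !linearZ /= [in RHS]mulrC.
Qed.

(* The vector field (omega, d( )) when l is (omega, ). *)
Definition dual_vfield (l : {linear form1 -> A^o}) : vfield :=
  VField (dual_vfield_subproof l).

(* ip is (omega, eta): the vector field (omega, d( )) has to be the metric dual
   of omega, which determines ip since 1-forms are locally combinations of
   differentials. *)
Definition is_inverse_metric (g : riemannian_metric)
    (ip : form1 -> {linear form1 -> A^o}) : Prop :=
  (forall v w, ip v w = ip w v) /\
  (forall w Y, tensor_eval g (dual_vfield (ip w)) Y = w Y).

Record connection := Connection {
  conn_val :> vfield -> vfield -> vfield;
  conn_lin : forall Y, linear (conn_val ^~ Y);
  conn_add : forall X Y Z, conn_val X (Y + Z) = conn_val X Y + conn_val X Z;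
  conn_leibniz : forall X (f : A) Y,
    conn_val X (f *: Y) = (X f : A) *: Y + f *: conn_val X Y
}.

Definition is_levi_civita (g : riemannian_metric) (nabla : connection) : Prop :=
  (forall X Y, nabla X Y - nabla Y X = lie X Y) /\
  (forall X Y Z, X (tensor_eval g Y Z) =
     tensor_eval g (nabla X Y) Z + tensor_eval g Y (nabla X Z)).

Section Connection.
Variable nabla : connection.

Lemma cov1_subproof X (w : form1) :
  (fun Y => X (w Y) - w (nabla X Y)) \in form1b.
Proof.
apply/asboolP => a Y Z.
rewrite conn_add conn_leibniz !form1D !form1Z vfieldD vfield_leibniz.
have aux (C : comPzRingType) (e xa wy xwy xwz wxy wxz : C) :
  xa * wy + e * xwy + xwz - (xa * wy + e * wxy + wxz) =
  e * (xwy - wxy) + (xwz - wxz) by ring.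
exact: aux.
Qed.

Definition cov1 X (w : form1) : form1 := Form1 (cov1_subproof X w).

Lemma cov2_alt X (b : form2) Y :
  X (b Y Y) - b (nabla X Y) Y - b Y (nabla X Y) = 0 :> A.
Proof.
by rewrite form2_alt vfield0 sub0r (form2_anti _ _ Y) opprK subrr.
Qed.

Lemma cov2_subproof X (b : form2) :
  bilinear_map (fun Y Z => X (b Y Z) - b (nabla X Y) Z - b Y (nabla X Z) : A^o).
Proof.
pose B Y Z : A := X (b Y Z) - b (nabla X Y) Z - b Y (nabla X Z).
have linl U a Y Z : B (a *: Y + Z) U = a * B Y U + B Z U.
  rewrite /B conn_add conn_leibniz !form2Dl !form2Zl vfieldD vfield_leibniz.
  have aux (C : comPzRingType) (e xa yu xyu xzu nyu nzu ynu znu : C) :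
    xa * yu + e * xyu + xzu - (xa * yu + e * nyu + nzu) - (e * ynu + znu) =
    e * (xyu - nyu - ynu) + (xzu - nzu - znu) by ring.
  exact: aux.
have anti Y Z : B Y Z = - B Z Y.
  have XN f : X (- f) = - X f by rewrite -sub0r vfieldB vfield0 sub0r.
  rewrite /B (form2_anti b Y Z) XN (form2_anti b (nabla X Y)).
  rewrite (form2_anti b Y (nabla X Z)) !opprD !opprK.
  by rewrite -!addrA [b Z _ + _]addrC.
split=> [Y a Z U|U a Y Z]; last exact: linl.
by rewrite -[LHS]/(B Y (a *: Z + U)) anti linl opprD -mulrN -!anti.
Qed.

Definition cov2 X (b : form2) : form2 := Form2 (cov2_subproof X b) (cov2_alt X b).

End Connection.

Section Operators.
Variables (g : riemannian_metric) (ip : form1 -> {linear form1 -> A^o}).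
Variable nabla : connection.
(* gs lists the terms g^1 (x) g^2 of an expression of g as a sum. *)
Variable gs : seq (form1 * form1).

Local Notation sharp w := (dual_vfield (ip w)).

Definition cov (v w : form1) : form1 := cov1 nabla (sharp v) w.

Definition codiff1 (w : form1) : A :=
  \sum_(u <- gs) cov u.2 w (sharp u.1).

Definition codiff2 (b : form2) : form1 :=
  \sum_(u <- gs) iprod (sharp u.1) (cov2 nabla (sharp u.2) b).

Definition hodge_laplacian (w : form1) : form1 :=
  d0 (codiff1 w) + codiff2 (d1 w).

(* The extension of the Hodge Laplacian to Omega^1 (x) Omega^1, computed on the
   sum of the terms listed in ts. *)
Definition hodge_laplacian_tensor (ts : seq (form1 * form1)) : tensor form1 form1 :=
  \sum_(t <- ts) (hodge_laplacian t.1 \ox t.2 + t.1 \ox hodge_laplacian t.2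
    + (\sum_(u <- gs) cov u.1 t.1 \ox cov u.2 t.2) *+ 2).

Definition form_bracket (v w : form1) : form1 := flat g (lie (sharp v) (sharp w)).

Definition curvature (v w z : form1) : form1 :=
  cov v (cov w z) - cov w (cov v z) - cov (form_bracket v w) z.

Definition ricci_map (w : form1) : form1 := \sum_(u <- gs) curvature w u.1 u.2.

Definition ricci : tensor form1 form1 := \sum_(u <- gs) u.1 \ox ricci_map u.2.

End Operators.

End VectorFields.

(* Main.v *)
Require Import Defs.
From HB Require Import structures.
From mathcomp Require Import all_boot all_order all_algebra.
From mathcomp Require Import all_classical all_reals all_analysis.
From mathcomp Require Import ring.
Set Implicit Arguments.
Unset Strict Implicit.
Unset Printing Implicit Defensive.

Import Order.TTheory GRing.Theory Num.Theory.
Local Open Scope ring_scope.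

(* Positivity of g makes X |-> g(X, .) injective, hence an isomorphism from
   vector fields to 1-forms, and an expression of g as a finite sum gives pairs
   (e, f) of vector fields with X = sum g(e, X) f for all X. So an element of
   Omega^1 (x) Omega^1 is determined by its values on pairs of vector fields, and
   no local coordinates are needed: the inverse metric sum e (x) f is symmetric
   and parallel for every bilinear map.

   The Weitzenbock formula then writes the Hodge Laplacian of the dual of W as
   the trace of the second covariant derivative of W plus a curvature term. In
   Delta(g) the second derivative and cross terms add up to the trace of the
   second covariant derivative of g, which vanishes because g is parallel, and the
   two curvature terms give - Ricci(X, Y) - Ricci(Y, X) = - 2 Ricci(X, Y). *)

(** * Linear maps and tensor products over a commutative ring *)

Lemma linear_sum_scale (A : pzRingType) (U W : lmodType A) (f : U -> W)
    (I : Type) (s : seq I) (a : I -> A) (x : I -> U) :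
  linear f -> f (\sum_(i <- s) a i *: x i) = \sum_(i <- s) a i *: f (x i).
Proof.
move=> lf.
have f0 : f 0 = 0 by have := lf (-1) 0 0; rewrite scaler0 addr0 scaleN1r addNr.
by elim: s => [|i s IHs]; rewrite ?big_nil // !big_cons lf IHs.
Qed.

Lemma tmul_bilinear (A : comPzRingType) (U V : lmodType A) :
  bilinear_map (fun (u : U) (v : V) => u \ox v).
Proof.
have addE (t t' : tensor U V) : t + t' = tensor_add t t' by [].
have scaleE a (t : tensor U V) : a *: t = tensor_scale a t by [].
split=> [u a v v'|v a u u']; rewrite /tmul scaleE addE tensor_scale_seq tensor_add_seq.
all: apply: tensor_of_seqP => W B BB.
all: rewrite /formal_sum !(big_cons, big_nil) /= !addr0.
all: have BZ z : B (a *: z) v = a *: B z v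
  by have := linear_sum_scale [:: tt] (fun=> a) (fun=> z) (BB.2 v); rewrite !big_seq1.
  by rewrite BB.1 BZ.
by have := BB.2 v a u u'; rewrite /= BZ.
Qed.

Lemma tensor_of_seqE (A : comPzRingType) (U V : lmodType A) (s : seq (U * V)) :
  tensor_of_seq s = \sum_(x <- s) x.1 \ox x.2.
Proof.
elim: s => [|[u v] s IHs]; first by rewrite big_nil.
by rewrite big_cons -IHs -[RHS]/(tensor_add _ _) tensor_add_seq.
Qed.

(** * Evaluation of tensors of 1-forms on pairs of vector fields *)

Section TensorEval.
Context (R : realType) (n : nat) (M : smooth_manifold R n).
Local Notation A := (smooth_fun M).
Implicit Types (X Y Z : vfield M) (t : tensor (form1 M) (form1 M)).

Lemma tensor_eval_seq s X Y :
  tensor_eval (tensor_of_seq s) X Y = \sum_(x <- s) x.1 X * x.2 Y.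
Proof. by rewrite /tensor_eval (tensor_lift_seq _ (bilinear_eval _ _)). Qed.

Lemma tensor_evalD t t' X Y :
  tensor_eval (t + t') X Y = tensor_eval t X Y + tensor_eval t' X Y.
Proof.
elim/tensor_ind: t => s; elim/tensor_ind: t' => s'.
by rewrite -[_ + _]/(tensor_add _ _) tensor_add_seq !tensor_eval_seq big_cat.
Qed.

Lemma tensor_evalZ (a : A) t X Y :
  tensor_eval (a *: t) X Y = a * tensor_eval t X Y.
Proof.
elim/tensor_ind: t => s.
rewrite -[_ *: _]/(tensor_scale _ _) tensor_scale_seq !tensor_eval_seq big_map.
by rewrite mulr_sumr; apply: eq_bigr => x _; rewrite mulrA.
Qed.

Lemma tensor_evalM (v w : form1 M) X Y : tensor_eval (v \ox w) X Y = v X * w Y.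
Proof. by rewrite tensor_eval_seq big_seq1. Qed.

Lemma tensor_eval_sum (I : Type) (s : seq I) (F : I -> tensor (form1 M) (form1 M)) X Y :
  tensor_eval (\sum_(i <- s) F i) X Y = \sum_(i <- s) tensor_eval (F i) X Y.
Proof.
apply: (big_morph (fun t => tensor_eval t X Y)) => [t t'|].
  exact: tensor_evalD.
by rewrite -[X in tensor_eval X](scale0r 0) tensor_evalZ mul0r.
Qed.

Lemma vfield_sum X (I : Type) (s : seq I) (F : I -> A) :
  X (\sum_(i <- s) F i) = \sum_(i <- s) X (F i) :> A.
Proof. by apply: (big_morph X); [exact: vfieldD | exact: vfield0]. Qed.

Lemma form1_sumE (I : Type) (s : seq I) (F : I -> form1 M) X :
  (\sum_(i <- s) F i) X = \sum_(i <- s) F i X :> A.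
Proof. by apply: (big_morph (fun w : form1 M => w X : A)). Qed.

Lemma tensor_evalDl t X Y Z : tensor_eval t (X + Y) Z = tensor_eval t X Z + tensor_eval t Y Z.
Proof.
elim/tensor_ind: t => s; rewrite !tensor_eval_seq -big_split.
by apply: eq_bigr => x _; rewrite form1D mulrDl.
Qed.

Lemma tensor_evalDr t X Y Z : tensor_eval t X (Y + Z) = tensor_eval t X Y + tensor_eval t X Z.
Proof. exact: (form1D (flat t X)). Qed.

Lemma tensor_evalZl t (a : A) X Z : tensor_eval t (a *: X) Z = a * tensor_eval t X Z.
Proof.
elim/tensor_ind: t => s; rewrite !tensor_eval_seq mulr_sumr.
by apply: eq_bigr => x _; rewrite form1Z mulrA.
Qed.

Lemma tensor_evalZr t (a : A) X Y : tensor_eval t X (a *: Y) = a * tensor_eval t X Y.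
Proof. exact: (form1Z (flat t X)). Qed.

Lemma tensor_evalNl t X Y : tensor_eval t (- X) Y = - tensor_eval t X Y.
Proof. by rewrite -scaleN1r tensor_evalZl mulN1r. Qed.

Lemma tensor_evalNr t X Y : tensor_eval t X (- Y) = - tensor_eval t X Y.
Proof. exact: (form1N (flat t X)). Qed.

Definition tensor_evalE := (tensor_evalDl, tensor_evalDr, tensor_evalNl,
  tensor_evalNr, tensor_evalZl, tensor_evalZr).

Lemma tensor_eval_suml t (I : Type) (s : seq I) (F : I -> vfield M) Y :
  tensor_eval t (\sum_(i <- s) F i) Y = \sum_(i <- s) tensor_eval t (F i) Y.
Proof.
apply: (big_morph (fun X => tensor_eval t X Y)) => [X Z|].
  exact: tensor_evalDl.
by rewrite -(scale0r 0) tensor_evalZl mul0r.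
Qed.

End TensorEval.

(** * Nondegeneracy of the metric and traces over the inverse metric *)

Section LeviCivita.
Context (R : realType) (n : nat) (M : smooth_manifold R n).
Local Notation A := (smooth_fun M).
Context (g : riemannian_metric M) (nabla : connection M).
Local Notation G := (tensor_eval g).
Implicit Types (X Y Z U V W : vfield M).

(** The difference [X - Y] has zero length, so positivity forbids it to be nonzero at any point. *)
Lemma metric_nondeg X Y : (forall Z, G X Z = G Y Z) -> X = Y.
Proof.
move=> XY; apply/eqP; rewrite -subr_eq0; apply/eqP.
have G0 : G (X - Y) (X - Y) = 0 by rewrite tensor_evalDl tensor_evalNl XY subrr.
apply: vfield_eqP => f; apply: val_inj; apply/funext => p.
have [//|fp] := eqVneq (smooth_val ((X - Y) f) p) 0.
have := @Defs.metric_pos _ _ _ g (X - Y) p (ex_intro _ f fp).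
by rewrite G0 -[smooth_val 0 p]/(0 : R) ltxx.
Qed.

(* The inverse metric is [\sum_(u <- s) u.1 (x) u.2]. *)
Definition inverse_metric_sum (s : seq (vfield M * vfield M)) : Prop :=
  forall X Y, \sum_(u <- s) G u.1 X * G u.2 Y = G X Y.

Section Trace.
Context (s : seq (vfield M * vfield M)) (hs : inverse_metric_sum s).

Lemma frame_expand X : X = \sum_(u <- s) G u.1 X *: u.2.
Proof.
apply: metric_nondeg => Z; rewrite tensor_eval_suml -hs.
by apply: eq_bigr => u _; rewrite tensor_evalZl.
Qed.

(** Expanding both arguments of [B] by [frame_expand] leaves, as coefficient of each [B u.2 w.2],
    one of the sums assumed to vanish. Identities of traces thus need checking only on the bilinear
    maps built from the metric. *)
Lemma bilinear_sum_eq0 (r : seq (vfield M * vfield M)) (L : lmodType A)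
    (B : vfield M -> vfield M -> L) :
  bilinear_map B -> (forall X Y, \sum_(v <- r) G v.1 X * G v.2 Y = 0) ->
  \sum_(v <- r) B v.1 v.2 = 0.
Proof.
move=> [Br Bl] r0.
transitivity (\sum_(v <- r) \sum_(u <- s) \sum_(w <- s)
    (G v.1 u.1 * G v.2 w.1) *: B u.2 w.2).
  apply: eq_bigr => v _.
  rewrite [in LHS](frame_expand v.1) (linear_sum_scale _ _ _ (Bl _)).
  apply: eq_bigr => u _; rewrite [in LHS](frame_expand v.2) (linear_sum_scale _ _ _ (Br _)).
  rewrite scaler_sumr; apply: eq_bigr => w _.
  by rewrite scalerA (Defs.metric_sym g u.1) (Defs.metric_sym g w.1).
rewrite exchange_big big1 // => u _; rewrite exchange_big big1 // => w _.
by rewrite -scaler_suml r0 scale0r.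
Qed.

Lemma trace_sym (B : vfield M -> vfield M -> A^o) : bilinear_map B ->
  \sum_(u <- s) B u.1 u.2 = \sum_(u <- s) B u.2 u.1.
Proof.
move=> BB; apply/eqP; rewrite -subr_eq0; apply/eqP.
have [Br Bl] := BB.
(* The inverse metric minus its transpose. *)
pose r := s ++ [seq (- u.2, u.1) | u <- s].
apply: etrans (bilinear_sum_eq0 (r := r) BB _) => [|X Y].
  rewrite big_cat big_map -sumrN /=; congr (_ + _); apply: eq_bigr => u _ /=.
  have := linear_sum_scale [:: tt] (fun=> -1) (fun=> u.2) (Bl u.1).
  by rewrite !big_seq1 !scaleN1r.
rewrite big_cat big_map /= hs -[RHS](subrr (G X Y)); congr (_ + _).
rewrite (Defs.metric_sym g X) -hs -sumrN; apply: eq_bigr => u _.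
by rewrite tensor_evalNl mulNr mulrC.
Qed.

Hypothesis lc : is_levi_civita g nabla.

(** Differentiate the identity [hs X Y] along [V], then subtract its instances with [X] or [Y]
    replaced by its covariant derivative. *)
Lemma inverse_metric_parallel V X Y :
  \sum_(u <- s) (G (nabla V u.1) X * G u.2 Y + G u.1 X * G (nabla V u.2) Y) = 0.
Proof.
have [_ comp] := lc.
have := congr1 (fun f : A => V f : A) (hs X Y); rewrite comp vfield_sum.
rewrite -(hs (nabla V X)) -(hs X (nabla V Y)) => /eqP; rewrite -subr_eq0 => /eqP.
rewrite -big_split -sumrB; apply: etrans; apply: eq_bigr => u _ /=.
by rewrite vfield_leibniz !comp; ring.
Qed.

Lemma trace_parallel (B : vfield M -> vfield M -> A^o) V : bilinear_map B ->
  \sum_(u <- s) (B (nabla V u.1) u.2 + B u.1 (nabla V u.2)) = 0.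
Proof.
move=> BB.
pose r := [seq (nabla V u.1, u.2) | u <- s] ++ [seq (u.1, nabla V u.2) | u <- s].
apply: etrans (bilinear_sum_eq0 (r := r) BB _) => [|X Y].
  by rewrite big_cat !big_map big_split.
by rewrite big_cat !big_map /= -big_split; exact: inverse_metric_parallel.
Qed.

End Trace.

(** * Symmetries of the Riemann curvature *)

Lemma connDl X Y Z : nabla (X + Y) Z = nabla X Z + nabla Y Z.
Proof. by have := conn_lin nabla Z 1 X Y; rewrite !scale1r. Qed.

Lemma connN X Y : nabla X (- Y) = - nabla X Y.
Proof.
have nabla0 : nabla X 0 = 0.
  by apply: (addrI (nabla X 0)); rewrite -conn_add !addr0.
by apply: (addrI (nabla X Y)); rewrite -conn_add !subrr nabla0.
Qed.

Lemma connNl X Y : nabla (- X) Y = - nabla X Y.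
Proof.
have nabla0 : nabla 0 Y = 0.
  by apply: (addrI (nabla 0 Y)); rewrite -connDl !addr0.
by apply: (addrI (nabla X Y)); rewrite -connDl !subrr nabla0.
Qed.

Definition riemann X Y Z : vfield M :=
  nabla X (nabla Y Z) - nabla Y (nabla X Z) - nabla (lie X Y) Z.

Definition second_deriv X Y Z : vfield M := nabla X (nabla Y Z) - nabla (nabla X Y) Z.

Lemma riemann_anti X Y Z : riemann Y X Z = - riemann X Y Z.
Proof.
by rewrite /riemann (lie_anti Y) connNl [in RHS]opprD !opprB opprK.
Qed.

Lemma lieE X Y f : lie X Y f = X (Y f) - Y (X f) :> A.
Proof. by []. Qed.

Lemma lie_jacobi X Y Z : lie X (lie Y Z) + lie Y (lie Z X) + lie Z (lie X Y) = 0.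
Proof.
apply: vfield_eqP => f.
rewrite -[LHS]/(X (lie Y Z f) - lie Y Z (X f) + (Y (lie Z X f) - lie Z X (Y f))
  + (Z (lie X Y f) - lie X Y (Z f)) : A) !lieE !vfieldB -[RHS]/(0 : A).
by ring.
Qed.

Lemma riemannDr X Y Z W : riemann X Y (Z + W) = riemann X Y Z + riemann X Y W.
Proof.
rewrite /riemann !conn_add; apply: metric_nondeg => V; rewrite !tensor_evalE.
by ring.
Qed.

Lemma riemannZr X Y (a : A) Z : riemann X Y (a *: Z) = a *: riemann X Y Z.
Proof.
rewrite /riemann !(conn_leibniz, conn_add); apply: metric_nondeg => V.
by rewrite !tensor_evalE lieE; ring.
Qed.

Hypothesis lc : is_levi_civita g nabla.

Lemma riemann_second_deriv X Y Z :
  riemann X Y Z = second_deriv X Y Z - second_deriv Y X Z.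
Proof.
rewrite /riemann /second_deriv -lc.1 connDl connNl.
by apply: metric_nondeg => V; rewrite !tensor_evalE; ring.
Qed.

(** With zero torsion, writing every bracket through [nabla] turns the Jacobi identity into this
    one. *)
Lemma riemann_bianchi X Y Z : riemann X Y Z + riemann Y Z X + riemann Z X Y = 0.
Proof.
rewrite -(lie_jacobi X Y Z) /riemann -!lc.1 !(conn_add, connN).
by apply: metric_nondeg => V; rewrite !tensor_evalE; ring.
Qed.

(** Metric compatibility expands [lie X Y f = X (Y f) - Y (X f)] for the function [f = G Z W]; the
    mixed first-order terms cancel. *)
Lemma riemann_skew X Y Z W : G (riemann X Y Z) W = - G Z (riemann X Y W).
Proof.
have [_ comp] := lc.
rewrite /riemann !tensor_evalE; apply/eqP; rewrite -subr_eq0; apply/eqP.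
have := subrr (lie X Y (G Z W) : A); rewrite {1}lieE !(comp, vfieldD) => H.
by apply: etrans H; ring.
Qed.
Lemma riemann_pair X Y Z W : G (riemann X Y Z) W = G (riemann Z W X) Y.
Proof.
have bianchi X1 X2 X3 X4 :
    G (riemann X1 X2 X3) X4 + G (riemann X2 X3 X1) X4 + G (riemann X3 X1 X2) X4 = 0.
  by rewrite -!tensor_evalDl riemann_bianchi -(scale0r 0) tensor_evalZl mul0r.
have double0 (f : A) : f + f = 0 -> f = 0.
  move=> ff; apply: val_inj; apply/funext => p; apply/eqP.
  have := congr1 (fun h : A => smooth_val h p) ff.
  rewrite -[smooth_val (f + f) p]/(smooth_val f p + smooth_val f p) => /eqP.
  by rewrite -mulr2n mulrn_eq0.
have anti X1 X2 X3 X4 : G (riemann X1 X2 X3) X4 = - G (riemann X2 X1 X3) X4.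
  by rewrite riemann_anti tensor_evalNl.
have skew X1 X2 X3 X4 : G (riemann X1 X2 X3) X4 = - G (riemann X1 X2 X4) X3.
  by rewrite riemann_skew (Defs.metric_sym g X3).
apply/eqP; rewrite -subr_eq0; apply/eqP/double0.
(* Up to the two skew symmetries the four Bianchi sums involve only six terms, and
   [b1 + b2 - b3 - b4] is twice the wanted difference. *)
have b1 := bianchi X Y Z W; have b2 := bianchi Y Z W X.
have b3 := bianchi Z W X Y; have b4 := bianchi W X Y Z.
rewrite (skew Y Z W X) (skew Z W Y X) (anti W Y Z X) in b2.
rewrite (anti W X Z Y) (skew X W Z Y) opprK (anti X Z W Y) (skew Z X W Y) opprK in b3.
rewrite (anti W X Y Z) (skew X Y W Z) (skew Y W X Z) in b4.
have aux (C : comPzRingType) (a a' b b' c c' : C) : a + b + c = 0 ->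
    - b - a' - c' = 0 -> a' + b' + c = 0 -> - b' - a - c' = 0 ->
    a - a' + (a - a') = 0.
  move=> h1 h2 h3 h4.
  have -> : a - a' + (a - a') =
    (a + b + c) + (- b - a' - c') - (a' + b' + c) - (- b' - a - c') by ring.
  by rewrite h1 h2 h3 h4 addr0 !subr0.
exact: aux b1 b2 b3 b4.
Qed.

(** * Derivatives of dual forms, and second derivatives of the metric *)

Lemma cov1_flat X W : cov1 nabla X (flat g W) = flat g (nabla X W).
Proof. by apply: form1_eqP => Y; rewrite /= lc.2 addrK. Qed.

Lemma d1_flat W X Y : d1 (flat g W) X Y = G (nabla X W) Y - G (nabla Y W) X.
Proof.
by rewrite /= -lc.1 !lc.2 tensor_evalDr tensor_evalNr; ring.
Qed.

Lemma cov2_flat W X Y Z : cov2 nabla X (d1 (flat g W)) Y Z =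
  G (second_deriv X Y W) Z - G (second_deriv X Z W) Y.
Proof.
rewrite -[LHS]/(X (d1 (flat g W) Y Z) - d1 (flat g W) (nabla X Y) Z
  - d1 (flat g W) Y (nabla X Z) : A) !d1_flat vfieldB !lc.2 /second_deriv.
by rewrite !tensor_evalE; ring.
Qed.

Section Frame.
Context (s : seq (vfield M * vfield M)) (hs : inverse_metric_sum s).

(* The Weitzenbock formula for the 1-form dual to [W]. *)
Lemma laplacian_flat W Y :
  Y (\sum_(u <- s) G (nabla u.2 W) u.1)
    + \sum_(u <- s) cov2 nabla u.2 (d1 (flat g W)) u.1 Y =
  \sum_(u <- s) (G (second_deriv u.2 u.1 W) Y + G (riemann Y u.2 W) u.1).
Proof.
have BB : bilinear_map (fun E F => G (nabla F W) E : A^o).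
  split=> [E a F F'|F a E E'].
    by rewrite conn_lin tensor_evalDl tensor_evalZl.
  by rewrite tensor_evalDr tensor_evalZr.
(* Subtracting [par] absorbs the derivatives of the frame, so that [Y] of the divergence becomes a
   trace of [second_deriv Y u.2 W]. Exchanging [Y] and [u.2] there yields the curvature term. *)
have par := trace_parallel hs lc Y BB.
rewrite vfield_sum -[LHS]subr0 -[X in _ - X = _]par -big_split -sumrB.
apply: eq_bigr => u _.
rewrite cov2_flat /= riemann_second_deriv lc.2 /second_deriv !tensor_evalE.
by ring.
Qed.

(** This is the second covariant derivative of the inverse metric. It is obtained by differentiating
    the first one, [P], which vanishes identically. *)
Lemma metric_second_deriv U V X Y :
  \sum_(t <- s) (G (second_deriv U V t.1) X * G t.2 Y
    + G (nabla V t.1) X * G (nabla U t.2) Y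
    + G (nabla U t.1) X * G (nabla V t.2) Y
    + G t.1 X * G (second_deriv U V t.2) Y) = 0.
Proof.
pose P W Z Z' : A :=
  \sum_(t <- s) (G (nabla W t.1) Z * G t.2 Z' + G t.1 Z * G (nabla W t.2) Z').
have P0 W Z Z' : P W Z Z' = 0 := inverse_metric_parallel hs lc W Z Z'.
transitivity (U (P V X Y) - P V (nabla U X) Y - P V X (nabla U Y)
  - P (nabla U V) X Y : A); last by rewrite !P0 vfield0 !subr0.
rewrite /P vfield_sum -!sumrB; apply: eq_bigr => t _.
rewrite vfieldD !vfield_leibniz !lc.2 /second_deriv !tensor_evalE.
by ring.
Qed.

(** * The Ricci form and the Laplacian of the metric *)

Definition ricci_form X Y : A := \sum_(u <- s) G (riemann X u.1 u.2) Y.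

Lemma ricci_form_swap X Y : ricci_form X Y = \sum_(u <- s) G (riemann X u.2 u.1) Y.
Proof.
apply: (trace_sym (B := fun E F => G (riemann X E F) Y) hs).
split=> [E a F F'|F a E E'].
  by rewrite riemannDr riemannZr tensor_evalDl tensor_evalZl.
(* Pair symmetry moves [E] into the second slot of [G], where linearity is known. *)
by rewrite !(riemann_pair X) tensor_evalDr tensor_evalZr.
Qed.

Lemma ricci_form_sym X Y : ricci_form X Y = ricci_form Y X.
Proof.
rewrite ricci_form_swap; apply: eq_bigr => u _.
rewrite riemann_pair riemann_anti tensor_evalNl riemann_skew opprK.
by rewrite (Defs.metric_sym g).
Qed.

Lemma ricci_form_expand X Y : \sum_(u <- s) G u.1 X * ricci_form u.2 Y = ricci_form X Y.
Proof.
have ricE Z : ricci_form Y Z = G (\sum_(v <- s) riemann Y v.1 v.2) Z.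
  by rewrite tensor_eval_suml.
rewrite ricci_form_sym ricE (Defs.metric_sym g) -hs.
by apply: eq_bigr => u _; rewrite ricci_form_sym ricE (Defs.metric_sym g u.2).
Qed.

End Frame.

(** Here [s] traces the derivatives while [r] expands the metric being differentiated; the two
    expansions may differ. *)
Lemma laplacian_metric (s r : seq (vfield M * vfield M)) X Y :
  inverse_metric_sum s -> inverse_metric_sum r ->
  \sum_(t <- r)
    ((\sum_(u <- s) (G (second_deriv u.2 u.1 t.1) X + G (riemann X u.2 t.1) u.1)) * G t.2 Y
     + G t.1 X * (\sum_(u <- s) (G (second_deriv u.2 u.1 t.2) Y + G (riemann Y u.2 t.2) u.1))
     + (\sum_(u <- s) G (nabla u.1 t.1) X * G (nabla u.2 t.2) Y) *+ 2) =
  - ricci_form s X Y - ricci_form s Y X.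
Proof.
move=> hs hr.
(* Symmetry of the trace splits the doubled cross term into the two mixed terms of
   [metric_second_deriv]. *)
have cross (T T' : vfield M) :
    \sum_(u <- s) G (nabla u.1 T) X * G (nabla u.2 T') Y =
    \sum_(u <- s) G (nabla u.2 T) X * G (nabla u.1 T') Y.
  apply: (trace_sym (B := fun E F => G (nabla E T) X * G (nabla F T') Y) hs).
  split=> [E a F F'|F a E E']; rewrite conn_lin tensor_evalDl tensor_evalZl.
    by rewrite mulrDr mulrCA.
  by rewrite mulrDl -mulrA.
rewrite !(ricci_form_swap hs) -!sumrN -[RHS]big_split.
transitivity (\sum_(t <- r) \sum_(u <- s)
   ((G (second_deriv u.2 u.1 t.1) X + G (riemann X u.2 t.1) u.1) * G t.2 Y
   + G t.1 X * (G (second_deriv u.2 u.1 t.2) Y + G (riemann Y u.2 t.2) u.1)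
   + (G (nabla u.1 t.1) X * G (nabla u.2 t.2) Y + G (nabla u.2 t.1) X * G (nabla u.1 t.2) Y))).
  apply: eq_bigr => t _; rewrite mulr2n [X in _ + (_ + X)]cross mulr_suml mulr_sumr.
  by rewrite -!big_split.
rewrite exchange_big; apply: eq_bigr => u _ /=.
(* For fixed [u], the Ricci terms are expanded over [r] and the vanishing second derivative is
   added. Skewness of the curvature then matches the summands and produces the minus signs. *)
rewrite (Defs.metric_sym g (riemann Y u.2 u.1)) -(hr X) -(hr (riemann X u.2 u.1)).
rewrite -!sumrN -[RHS]addr0 -[X in _ = _ + X](metric_second_deriv hr u.2 u.1 X Y) -!big_split.
apply: eq_bigr => t _ /=.
rewrite (riemann_skew X) (riemann_skew Y).
by ring.
Qed.

(** * Transfer from vector fields to 1-forms by the musical isomorphisms *)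

Section Forms.
Context (ip : form1 M -> {linear form1 M -> A^o}) (hip : is_inverse_metric g ip).
Local Notation sharp w := (dual_vfield (ip w)).
Implicit Types (v w z : form1 M).

Lemma flat_sharp w : flat g (sharp w) = w.
Proof. by apply: form1_eqP => Y; apply: hip.2. Qed.

Lemma sharp_flat X : sharp (flat g X) = X.
Proof. by apply: metric_nondeg => Z; rewrite hip.2. Qed.

Lemma cov_flat v w : cov ip nabla v w = flat g (nabla (sharp v) (sharp w)).
Proof. by rewrite -cov1_flat flat_sharp. Qed.

Lemma curvature_flat v w z :
  curvature g ip nabla v w z = flat g (riemann (sharp v) (sharp w) (sharp z)).
Proof.
apply: form1_eqP => Y; rewrite /curvature !cov_flat /form_bracket !sharp_flat.
rewrite -[LHS]/(G _ Y - G _ Y - G _ Y) -[RHS]/(G _ Y).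
by rewrite /riemann !tensor_evalE.
Qed.

Definition sharp_seq (ts : seq (form1 M * form1 M)) :=
  [seq (sharp t.1, sharp t.2) | t <- ts].

Lemma sharp_seq_sum ts X Y : \sum_(v <- sharp_seq ts) G v.1 X * G v.2 Y =
  tensor_eval (\sum_(t <- ts) t.1 \ox t.2) X Y.
Proof.
rewrite tensor_eval_sum big_map; apply: eq_bigr => t _.
by rewrite tensor_evalM !hip.2.
Qed.

Lemma inverse_metric_sharp ts :
  metric_tensor g = \sum_(t <- ts) t.1 \ox t.2 -> inverse_metric_sum (sharp_seq ts).
Proof. by move=> gts X Y; rewrite sharp_seq_sum -gts. Qed.

(** The difference is a sum of products of forms. Their dual fields satisfy the hypothesis of
    [bilinear_sum_eq0], which is applied to the tensor-valued map sending [X], [Y] to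
    [flat g X \ox flat g Y]. *)
Lemma tensor_eval_inj s (t t' : tensor (form1 M) (form1 M)) : inverse_metric_sum s ->
  (forall X Y, tensor_eval t X Y = tensor_eval t' X Y) -> t = t'.
Proof.
move=> hs tt'; apply/eqP; rewrite -subr_eq0; apply/eqP.
have : forall X Y, tensor_eval (t - t') X Y = 0.
  by move=> X Y; rewrite tensor_evalD -scaleN1r tensor_evalZ tt' mulN1r subrr.
elim/tensor_ind: (t - t') => q; rewrite tensor_of_seqE => q0.
have flat_lin : linear (flat g).
  by move=> a X Y; apply: form1_eqP => Z; rewrite /= tensor_evalDl tensor_evalZl.
have [tr tl] := tmul_bilinear (form1 M) (form1 M).
have BB : bilinear_map (fun X Y => flat g X \ox flat g Y).
  by split=> [X a Y Y'|Y a X X']; rewrite flat_lin ?tr // (tl (flat g Y)).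
apply: etrans (bilinear_sum_eq0 hs (r := sharp_seq q) BB _).
  by rewrite big_map; apply: eq_bigr => x _; rewrite !flat_sharp.
by move=> X Y; rewrite sharp_seq_sum.
Qed.

Context (gs : seq (form1 M * form1 M)).
Hypothesis hgs : metric_tensor g = \sum_(u <- gs) u.1 \ox u.2.
Local Notation s := (sharp_seq gs).

Lemma hodge_laplacianE w Y : hodge_laplacian ip nabla gs w Y =
  \sum_(u <- s) (G (second_deriv u.2 u.1 (sharp w)) Y + G (riemann Y u.2 (sharp w)) u.1).
Proof.
rewrite -laplacian_flat; last exact: inverse_metric_sharp.
rewrite -[LHS]/(Y (codiff1 ip nabla gs w) + codiff2 ip nabla gs (d1 w) Y : A).
rewrite /codiff1 /codiff2 form1_sumE !big_map flat_sharp; congr (Y _ + _).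
by apply: eq_bigr => u _; rewrite cov_flat.
Qed.

Lemma ricci_eval X Y : tensor_eval (ricci g ip nabla gs) X Y = ricci_form s X Y.
Proof.
rewrite -ricci_form_expand; last exact: inverse_metric_sharp.
rewrite tensor_eval_sum big_map; apply: eq_bigr => u _.
rewrite tensor_evalM hip.2 form1_sumE /ricci_form big_map; congr (_ * _).
by apply: eq_bigr => v _; rewrite curvature_flat.
Qed.

Lemma hodge_laplacian_tensor_eval ts X Y :
  metric_tensor g = \sum_(t <- ts) t.1 \ox t.2 ->
  tensor_eval (hodge_laplacian_tensor ip nabla gs ts) X Y =
    - ricci_form s X Y - ricci_form s Y X.
Proof.
move=> /inverse_metric_sharp hts.
rewrite -(laplacian_metric _ _ (inverse_metric_sharp hgs) hts).
rewrite tensor_eval_sum [RHS]big_map; apply: eq_bigr => t _.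
rewrite mulr2n !tensor_evalD !tensor_evalM -mulr2n !hodge_laplacianE !hip.2.
congr (_ + _ *+ 2); rewrite tensor_eval_sum big_map; apply: eq_bigr => u _.
by rewrite tensor_evalM !cov_flat.
Qed.

End Forms.
End LeviCivita.

Theorem corollary2p14 (R : realType) (n : nat) (M : smooth_manifold R n)
    (g : riemannian_metric M)
    (ip : form1 M -> {linear form1 M -> (smooth_fun M)^o})
    (nabla : connection M)
    (gs ts : seq (form1 M * form1 M)) :
  is_inverse_metric g ip ->
  is_levi_civita g nabla ->
  metric_tensor g = \sum_(u <- gs) u.1 \ox u.2 ->
  metric_tensor g = \sum_(t <- ts) t.1 \ox t.2 ->
  ricci g ip nabla gs =
    cst_smooth M (- 2^-1) *: hodge_laplacian_tensor ip nabla gs ts.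
Proof.
move=> hip lc hgs hts.
have hs := inverse_metric_sharp hip hgs.
apply: (tensor_eval_inj hip hs) => X Y.
rewrite tensor_evalZ (hodge_laplacian_tensor_eval lc hip hgs) // ricci_eval //.
rewrite (ricci_form_sym lc hs Y X) -smooth_scaleE -opprD scaleNr scalerN opprK -mulr2n.
by rewrite -[X in _ *: X](@scaler_nat R) scalerA mulVf ?scale1r // pnatr_eq0.
Qed.
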